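(* Let $K=\mathbb R$, $m\ge5$, $\omega\in\Omega$, and let $b=b_{\omega ij}$ be a block with $\omega\in\operatorname{supp}(b)$. Let $c=c_b^{\delta_\omega}$ and $A_\lambda=\ker(L(c)-\lambda\operatorname{Id})$ in $\mathbb A^{\delta_\omega}(G_2(m))$. Then the even part $\mathbb A_+(b)=A_1\oplus A_{-1/2}\oplus A_0$ splits as a direct product of algebras $$\mathbb A_+(b)\;\cong\;\mathbb M(\mathbb R^2)\times\mathbb A^{\mathbf 1}(G_2(m-3)),$$ where the first factor, spanned by $g=e_{\omega i}+e_{\omega j}+e_{ij}$, $a_1=e_{\omega i}-e_{\omega j}$, $a_2=e_{\omega i}-e_{ij}$, is a polar algebra, built from the rank-$1$ symmetric Clifford system on $\mathbb R^2$, and the second factor is the incidence algebra of $G_2(m-3)$ with trivial decoration. Thus for $m\ge5$, $\mathbb A_+(b)$ always has a direct summand which is a polar algebra. The second factor is nontrivial (has nonzero product) for $m\ge6$; for $m=5$ it is a $1$-dimensional null algebra (zero product).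
   Context: $\Omega=\{1,\dots,m\}$. For $n\ge2$ the Grassmannian geometry $G_2(n)$ on an $n$-set has points the $2$-subsets $ij=\{i,j\}$ and blocks $b_{ijk}=\{ij,ik,jk\}$ for $3$-subsets $\{i,j,k\}$; $\operatorname{supp}(b_{ijk})=\{i,j,k\}$. For a decoration $\delta$ (map from blocks to $\{\pm1\}$), $\mathbb A^\delta(G_2(n))$ is the commutative $K$-algebra with basis $\{e_p\}$ indexed by points and product $e_{ij}\circ_\delta e_{ik}=\delta(b_{ijk})e_{jk}$ for distinct $i,j,k$, $e_p\circ_\delta e_q=0$ if $p=q$ or $p\cap q=\varnothing$; $\mathbf 1$ is the trivial decoration. The block idempotent is $c_b^\delta=\tfrac12\delta(b)\sum_{p\in b}e_p$; $L(c):x\mapsto c\circ_\delta x$. The star decoration at $\omega$ is $\delta_\omega(b)=-1$ if $\omega\in\operatorname{supp}(b)$, and $1$ otherwise. $\mathbb A_+(b)=\operatorname{span}\{e_p:|p\cap\operatorname{supp}(b)|\text{ even}\}$ is the even part of the $\mathbb Z_2$-grading given by the automorphism $e_p\mapsto(-1)^{|p\cap\operatorname{supp}(b)|}e_p$. $\mathbb M(\mathbb R^2)$ is the commutative algebra on $\mathbb R^2\oplus\operatorname{Sym}_0(\mathbb R^2)$, where $\operatorname{Sym}_0(\mathbb R^2)$ is the space of symmetric $2\times2$ matrices with zero diagonal and $\pi$ is the projection of symmetric matrices killing the diagonal, with product $(x,X)\diamond(y,Y)=(-Xy-Yx,\ \pi(XY+YX-xy^T-yx^T))$; it carries the inner product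 $\langle(x,X),(y,Y)\rangle=x^Ty+\tfrac12\operatorname{tr}(XY)$. A metrized commutative algebra (i.e. with an inner product satisfying $\langle xy,z\rangle=\langle x,yz\rangle$) is polar if it has an orthogonal $\mathbb Z_2$-grading $\mathbb A_0\oplus\mathbb A_1$ with $\mathbb A_0\mathbb A_0=0$ and $x_0(x_0x_1)=\langle x_0,x_0\rangle x_1$ for all $x_i\in\mathbb A_i$. A symmetric Clifford system on a Euclidean space $V$ is a tuple of self-adjoint operators $P_1,\dots,P_q$ on $V$ with $P_sP_t+P_tP_s=2\delta_{st}\operatorname{Id}$; $q$ is its rank. A polar algebra is built from the symmetric Clifford system $x_1\mapsto z_sx_1$ on $\mathbb A_1$, where $z_1,\dots,z_q$ is an orthonormal basis of $\mathbb A_0$. *)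

(* Defs.v *)
From HB Require Import structures.
From mathcomp Require Import all_boot all_order all_algebra.
From mathcomp Require Import reals.

Set Implicit Arguments.
Unset Strict Implicit.
Unset Printing Implicit Defensive.

Import Order.TTheory GRing.Theory Num.Theory.
Local Open Scope ring_scope.

Definition point (n : nat) := {p : {set 'I_n} | #|p| == 2%N}.

(* A block b_ijk = {ij, ik, jk} is represented by its support {i, j, k}; its
   points are the 2-subsets of the support. *)
Definition block (n : nat) := {b : {set 'I_n} | #|b| == 3%N}.

(* [true] stands for the sign -1, so that the sign of b is (-1) ^+ d b. *)
Definition decoration (n : nat) := block n -> bool.

Definition trivial_dec (n : nat) : decoration n := fun=> false.
Definition star_dec (n : nat) (w : 'I_n) : decoration n := fun b => w \in val b.

Notation incalg K n := {ffun point n -> K^o}.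

Section IncidenceAlgebra.
Variables (K : fieldType) (n : nat).
Local Notation A := (incalg K n).

(* For a 2-subset s this is the basis vector e_s; it is 0 for any other s. *)
Definition basis_e (s : {set 'I_n}) : A := [ffun p => (val p == s)%:R].

(* The sum has at most one term: val p :|: val q is a block iff p and q are
   distinct and meet, and then the block minus their common element is the
   third point (see [incmul_basis], [incmul_basis_same] and
   [incmul_basis_disjoint] below). *)
Definition basis_mul (d : decoration n) (p q : point n) : A :=
  \sum_(b : block n | val b == val p :|: val q)
    (-1) ^+ d b *: basis_e (val b :\: (val p :&: val q)).

Definition incmul (d : decoration n) (x y : A) : A :=
  \sum_(p : point n) \sum_(q : point n) (x p * y q) *: basis_mul d p q.

Definition incmul_op (d : decoration n) (x : A) : 'End(A) :=
  linfun (incmul d x).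

Definition block_idem (d : decoration n) (b : block n) : A :=
  (2^-1 * (-1) ^+ d b) *: \sum_(p : point n | val p \subset val b) basis_e (val p).

Definition block_eigenspace (d : decoration n) (b : block n) (lam : K) :
    {vspace A} :=
  lker (incmul_op d (block_idem d b) - lam *: \1%VF).

Definition even_basis (b : block n) : seq A :=
  [seq basis_e (val p) | p <- enum {: point n} & ~~ odd #|val p :&: val b|].

Definition even_part (b : block n) : {vspace A} := <<even_basis b>>%VS.

Fact incmul_is_linear d x : linear (incmul d x).
Proof.
move=> a y z; rewrite /incmul scaler_sumr -big_split; apply: eq_bigr => p _ /=.
rewrite scaler_sumr -big_split; apply: eq_bigr => q _ /=.
by rewrite scalerA -scalerDl !ffunE mulrDr; congr ((_ + _) *: _); rewrite mulrCA.
Qed.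

Lemma incmul_opE d x y : incmul_op d x y = incmul d x y.
Proof.
pose HBl := GRing.isLinear.Build K A A _ _ (incmul_is_linear d x).
pose l : {linear A -> A} := HB.pack (incmul d x) HBl.
exact: (lfunE l).
Qed.

Lemma incmul_basisE d (p q : point n) :
  incmul d (basis_e (val p)) (basis_e (val q)) = basis_mul d p q.
Proof.
rewrite /incmul (bigD1 p) //= (bigD1 q) //= !ffunE !eqxx mulr1 scale1r.
rewrite big1 ?addr0 => [|r /negPf nrq]; last first.
  by rewrite !ffunE (inj_eq val_inj) nrq mulr0 scale0r.
rewrite big1 ?addr0 // => r /negPf nrp; apply: big1 => s _.
by rewrite !ffunE (inj_eq val_inj) nrp mul0r scale0r.
Qed.

Lemma incmul_basis d (i j k : 'I_n) (b : block n) :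
  val b = [set i; j; k] ->
  incmul d (basis_e [set i; j]) (basis_e [set i; k]) =
    (-1) ^+ d b *: basis_e [set j; k].
Proof.
move=> bE; have c3 := valP b; rewrite bE in c3.
have [nij nik njk]: [/\ i != j, i != k & j != k].
  move: c3; rewrite setUC !cardsU1 cards1 !inE.
  by rewrite (eq_sym k) (eq_sym k); do !case: eqP.
have cij : #|[set i; j]| == 2%N by rewrite cards2 nij.
have cik : #|[set i; k]| == 2%N by rewrite cards2 nik.
pose p : point n := exist _ [set i; j] cij; pose q : point n := exist _ [set i; k] cik.
rewrite (incmul_basisE d p q) /basis_mul /=.
have uE : val b = [set i; j] :|: [set i; k].
  by rewrite bE; apply/setP=> x; rewrite !inE; do !case: eqP.
rewrite (eq_bigl (pred1 b)) => [|c]; last by rewrite /= -uE (inj_eq val_inj).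
rewrite big_pred1_eq; congr (_ *: basis_e _).
rewrite bE; apply/setP=> x; rewrite !inE.
have [->|nxi] := eqVneq x i; first by rewrite (negPf nij) (negPf nik).
by have [->|nxj] := eqVneq x j; rewrite ?(negPf njk) //=.
Qed.

Lemma incmul_basis_same d (p : point n) :
  incmul d (basis_e (val p)) (basis_e (val p)) = 0.
Proof.
rewrite incmul_basisE /basis_mul big1 // => b /eqP bE.
by have := valP b; rewrite bE setUid (eqP (valP p)).
Qed.

Lemma incmul_basis_disjoint d (p q : point n) : val p :&: val q = set0 ->
  incmul d (basis_e (val p)) (basis_e (val q)) = 0.
Proof.
move=> pq0; rewrite incmul_basisE /basis_mul big1 // => b /eqP bE.
by have := valP b; rewrite bE cardsU pq0 cards0 (eqP (valP p)) (eqP (valP q)).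
Qed.

End IncidenceAlgebra.

Section MAlgebra.
Variables (K : fieldType) (n : nat).

(* On symmetric matrices this is the projection pi killing the diagonal. *)
Definition offdiag (X : 'M[K]_n) : 'M[K]_n :=
  \matrix_(i, j) (if i == j then 0 else X i j).

Fact offdiag_is_linear : linear offdiag.
Proof.
by move=> a X Y; apply/matrixP=> i j; rewrite !mxE; case: eqP; rewrite ?mulr0 ?addr0.
Qed.
HB.instance Definition _ :=
  GRing.isLinear.Build K 'M[K]_n 'M[K]_n _ offdiag offdiag_is_linear.

Definition sym0 : {vspace 'M[K]_n} :=
  (lker (linfun trmx - \1%VF) :&: lker (linfun offdiag - \1%VF))%VS.

Lemma mem_sym0 X : (X \in sym0) = (X^T == X) && (offdiag X == X).
Proof.
by rewrite memv_cap !memv_ker !lfunE /= !opp_lfunE !id_lfunE !lfunE !subr_eq0.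
Qed.

Lemma mem_sym0P (X : 'M[K]_n) :
  reflect ((forall i j, X i j = X j i) /\ (forall i, X i i = 0)) (X \in sym0).
Proof.
rewrite mem_sym0; apply: (iffP andP) => [[/eqP sX /eqP dX]|[sX dX]]; split.
- by move=> i j; rewrite -{1}sX mxE.
- by move=> i; rewrite -dX mxE eqxx.
- by apply/eqP/matrixP=> i j; rewrite mxE.
- by apply/eqP/matrixP=> i j; rewrite mxE; case: eqP => // ->; rewrite dX.
Qed.

Local Notation Malg := ('cV[K]_n * subvs_of sym0)%type.

Definition Mmul_mx (x : 'cV[K]_n) (X : 'M[K]_n) (y : 'cV[K]_n) (Y : 'M[K]_n) :=
  offdiag (X *m Y + Y *m X - x *m y^T - y *m x^T).

(* [vsproj sym0] only re-types its argument, which lies in sym0: see [Mmul2E]. *)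
Definition Mmul (u v : Malg) : Malg :=
  let x := u.1 in let X := vsval u.2 in
  let y := v.1 in let Y := vsval v.2 in
  (- (X *m y) - Y *m x, vsproj sym0 (Mmul_mx x X y Y)).

Definition Mip (u v : Malg) : K :=
  (u.1^T *m v.1) 0 0 + 2^-1 * \tr (vsval u.2 *m vsval v.2).

Lemma Mmul2E u v :
  vsval (Mmul u v).2 = Mmul_mx u.1 (vsval u.2) v.1 (vsval v.2).
Proof.
apply: vsprojK; rewrite mem_sym0.
have := subvsP u.2; have := subvsP v.2; rewrite !mem_sym0.
case/andP=> /eqP sY _ /andP[/eqP sX _]; apply/andP; split; apply/eqP; last first.
  by apply/matrixP=> i j; rewrite !mxE; case: eqP.
have <-: forall Z : 'M[K]_n, offdiag Z^T = (offdiag Z)^T.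
  by move=> Z; apply/matrixP=> i j; rewrite !mxE eq_sym.
congr offdiag; rewrite !(linearB, linearD) /= !trmx_mul !trmxK sX sY.
by rewrite [_ *m _ + _]addrC addrAC.
Qed.

End MAlgebra.

Notation Malg K n := ('cV[K]_n * subvs_of (sym0 K n))%type.

(* Algebras are carried by a subspace U of a space V with a product mul, so that
   subalgebras such as A_+(b) need no separate type. *)
Section Algebras.
Variables (K : fieldType) (V : vectType K) (mul : V -> V -> V).

Definition comm_algebra (U : {vspace V}) : Prop :=
  [/\ {in U &, forall x y, mul x y \in U},
      {in U &, forall x y, mul x y = mul y x} &
      forall a, {in U & &, forall x y z,
        mul (a *: x + y) z = a *: mul x z + mul y z}].

Definition direct_product (B U1 U2 : {vspace V}) : Prop :=
  [/\ comm_algebra U1, comm_algebra U2,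
      B = (U1 + U2)%VS /\ directv (U1 + U2) &
      forall x y, x \in U1 -> y \in U2 -> mul x y = 0 /\ mul y x = 0].

Definition direct_summand (U B : {vspace V}) : Prop :=
  exists W : {vspace V}, direct_product B U W.

End Algebras.

Definition prod_mul (T1 T2 : Type) (mul1 : T1 -> T1 -> T1) (mul2 : T2 -> T2 -> T2)
    (u v : T1 * T2) : T1 * T2 :=
  (mul1 u.1 v.1, mul2 u.2 v.2).

Definition alg_iso (K : fieldType) (V1 V2 : vectType K)
    (mul1 : V1 -> V1 -> V1) (mul2 : V2 -> V2 -> V2)
    (f : 'Hom(V1, V2)) (B : {vspace V2}) : Prop :=
  [/\ injective f, limg f = B & forall u v, f (mul1 u v) = mul2 (f u) (f v)].

Section Polar.
Variable R : realType.

Definition inner_product (V : vectType R) (U : {vspace V}) (ip : V -> V -> R) :=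
  [/\ {in U &, forall x y, ip x y = ip y x},
      forall a, {in U & &, forall x y z, ip (a *: x + y) z = a * ip x z + ip y z} &
      {in U, forall x, x != 0 -> 0 < ip x x}].

Definition metrized_algebra (V : vectType R) (mul : V -> V -> V)
    (ip : V -> V -> R) (U : {vspace V}) : Prop :=
  [/\ comm_algebra mul U, inner_product U ip &
      {in U & &, forall x y z, ip (mul x y) z = ip x (mul y z)}].

Record polar_grading (V : vectType R) (mul : V -> V -> V) (ip : V -> V -> R)
    (U A0 A1 : {vspace V}) : Prop := PolarGrading {
  polar_sum : U = (A0 + A1)%VS;
  polar_direct : directv (A0 + A1);
  polar_orth : forall x y, x \in A0 -> y \in A1 -> ip x y = 0;
  polar_mul00 : forall x y, x \in A0 -> y \in A0 -> mul x y = 0;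
  polar_mul01 : forall x y, x \in A0 -> y \in A1 -> mul x y \in A1;
  polar_mul11 : forall x y, x \in A1 -> y \in A1 -> mul x y \in A0;
  polar_sq : forall x y, x \in A0 -> y \in A1 -> mul x (mul x y) = ip x x *: y }.

Definition polar_algebra (V : vectType R) (mul : V -> V -> V)
    (ip : V -> V -> R) (U : {vspace V}) : Prop :=
  metrized_algebra mul ip U /\
  exists A0 A1 : {vspace V}, polar_grading mul ip U A0 A1.

Definition sym_clifford_system (W : vectType R) (ip : W -> W -> R) (q : nat)
    (P : 'I_q -> 'End(W)) : Prop :=
  [/\ inner_product fullv ip,
      forall s x y, ip (P s x) y = ip x (P s y) &
      forall s t x, P s (P t x) + P t (P s x) = (2 * (s == t)%:R) *: x].

Definition orthonormal_basis (V : vectType R) (ip : V -> V -> R)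
    (U : {vspace V}) (q : nat) (z : q.-tuple V) : Prop :=
  basis_of U z /\
  forall s t : 'I_q, ip (tnth z s) (tnth z t) = (s == t)%:R.

(* U is polar, and for a suitable orthonormal basis z of A_0 the operators
   x |-> z_s x on A_1 are carried to the system P by an isometry u : W -> A_1. *)
Definition polar_from (V : vectType R) (mul : V -> V -> V) (ip : V -> V -> R)
    (U : {vspace V}) (W : vectType R) (ipW : W -> W -> R) (q : nat)
    (P : 'I_q -> 'End(W)) : Prop :=
  metrized_algebra mul ip U /\
  exists A0 A1 : {vspace V}, exists z : q.-tuple V, exists u : 'Hom(W, V),
    [/\ polar_grading mul ip U A0 A1, orthonormal_basis ip A0 z,
        limg u = A1 /\ (forall x y, ip (u x) (u y) = ipW x y) &
        forall s x, mul (tnth z s) (u x) = u (P s x)].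

Definition dot (n : nat) (x y : 'cV[R]_n) : R := (x^T *m y) 0 0.

(* The rank-1 symmetric Clifford system on R^2 given by a reflection, here the
   swap of coordinates; up to isometry it is the only one besides Id and -Id. *)
Definition clifford_R2 (s : 'I_1) : 'End('cV[R]_2) :=
  linfun (mulmx (\matrix_(i < 2, j < 2) (i != j)%:R : 'M[R]_2)).

(* The inner product for which the basis e_p is orthonormal. *)
Definition incip (n : nat) (x y : incalg R n) : R :=
  \sum_(p : point n) x p * y p.

End Polar.

(* Main.v *)
From HB Require Import structures.
Require Import Defs.
From mathcomp Require Import all_boot all_order all_algebra.
From mathcomp Require Import reals.
From mathcomp Require Import ring lra.

Set Implicit Arguments.
Unset Strict Implicit.
Unset Printing Implicit Defensive.

Import Order.TTheory GRing.Theory Num.Theory.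
Local Open Scope ring_scope.

(* A point p meets the support of b = {w, i, j} in an even number of elements
   iff p is one of the three points of b or is disjoint from b.  As b has sign
   -1, a product of two distinct points of b is minus the third one, which is
   the multiplication table of M(R^2) in the basis of the two unit vectors of
   R^2 and the swap matrix S.  The points disjoint from b only generate blocks
   avoiding w, whose sign is 1, and they annihilate the points of b.  The
   idempotent c is -1/2 times the sum of the points of b: it has eigenvalues
   1, -1/2, -1/2 on them, it kills the points disjoint from b, and on
   the span of e_wk, e_ik, e_jk for k outside b it has eigenvalues -1, 1/2, 1/2,
   so that the eigenspaces for 1, -1/2, 0 lie in the even part. *)

(** * The product of an incidence algebra *)

Section IncidenceAlgebraTheory.
Variables (K : fieldType) (n : nat) (d : decoration n).
Local Notation A := (incalg K n).
Local Notation mul := (incmul d).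

Lemma incmulC : commutative (mul : A -> A -> A).
Proof.
move=> x y; rewrite /incmul exchange_big; apply: eq_bigr => q _ /=.
apply: eq_bigr => p _; rewrite mulrC; congr (_ *: _).
by rewrite /basis_mul setUC setIC.
Qed.

Fact incmul_bilinear : bilinear_for *:%R *:%R (mul : A -> A -> A).
Proof.
split=> [y|x]; last exact: incmul_is_linear.
by move=> a x z; rewrite /= !(incmulC _ y) incmul_is_linear.
Qed.
HB.instance Definition _ := bilinear_isBilinear.Build K A A A *:%R *:%R
  (mul : A -> A -> A) incmul_bilinear.

Lemma incalg_basis_sum (x : A) : x = \sum_p x p *: basis_e K (val p).
Proof.
apply/ffunP=> q; rewrite sum_ffunE (bigD1 q) //= big1 ?addr0 => [|p /negPf npq].
  by rewrite !ffunE eqxx; apply/esym/mulr1.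
by rewrite !ffunE (inj_eq val_inj) eq_sym npq; apply: mulr0.
Qed.

(* T(p, q, r) = sign(b) if p, q, r are the three points of a block b, and 0
   otherwise: for r the symmetric difference of p and q, each of the three is
   the symmetric difference of the two others, and p :|: q = q :|: r. *)
Lemma basis_mul_cycle (p q r : point n) :
  basis_mul K d p q r = basis_mul K d q r p.
Proof.
rewrite /basis_mul !sum_ffunE big_mkcond [RHS]big_mkcond; apply: eq_bigr => b _.
rewrite !ffunE.
have -> : (if val b == val p :|: val q then
     (-1) ^+ d b *: ((val r == val b :\: (val p :&: val q))%:R : K^o) else 0)
   = (-1) ^+ d b *: (((val b == val p :|: val q) &&
       (val r == val b :\: (val p :&: val q)))%:R : K^o).
  by case: eqP => //= _; rewrite scaler0.
have -> : (if val b == val q :|: val r then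
     (-1) ^+ d b *: ((val p == val b :\: (val q :&: val r))%:R : K^o) else 0)
   = (-1) ^+ d b *: (((val b == val q :|: val r) &&
       (val p == val b :\: (val q :&: val r)))%:R : K^o).
  by case: eqP => //= _; rewrite scaler0.
congr (_ *: (_%:R)); congr nat_of_bool; apply/andP/andP=> -[/eqP-> /eqP->];
  by split; apply/eqP/setP=> x; rewrite !inE; do !case: (x \in _).
Qed.

End IncidenceAlgebraTheory.

(** * The invariant inner product with orthonormal points *)

Section Incip.
Variables (R : realType) (n : nat).
Local Notation A := (incalg R n).

Lemma incipC : commutative (@incip R n).
Proof. by move=> x y; apply: eq_bigr => p _; rewrite mulrC. Qed.

Fact incip_bilinear : bilinear_for *%R *%R (@incip R n : A -> A -> R^o).
Proof.
have lin x : scalar (@incip R n x).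
  move=> a y z; rewrite /incip mulr_sumr -big_split; apply: eq_bigr => p _.
  by rewrite !ffunE mulrDr /= mulrCA.
by split=> // y a x z; rewrite /= !(incipC _ y) lin.
Qed.
HB.instance Definition _ := bilinear_isBilinear.Build R A A R^o *%R *%R
  (@incip R n : A -> A -> R^o) incip_bilinear.

Lemma incip_basis_e (x : A) (p : point n) : incip x (basis_e R (val p)) = x p.
Proof.
rewrite /incip (bigD1 p) //= big1 ?addr0 => [|q /negPf npq].
  by rewrite !ffunE eqxx mulr1.
by rewrite !ffunE (inj_eq val_inj) npq mulr0.
Qed.

(** Both sides expand into the sum over p, q, r of x_p y_q z_r times a structure constant, T(p, q,
    r) on the left and T(q, r, p) on the right. These agree by [basis_mul_cycle]. *)
Lemma incip_incmulA (d : decoration n) (x y z : A) :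
  incip (incmul d x y) z = incip x (incmul d y z).
Proof.
have E x' y' r : incmul d x' y' r = \sum_p \sum_q x' p * y' q * basis_mul R d p q r.
  rewrite sum_ffunE; apply: eq_bigr => p _; rewrite sum_ffunE.
  by apply: eq_bigr => q _; rewrite ffunE.
rewrite /incip; under eq_bigr do rewrite E mulr_suml.
rewrite exchange_big; apply: eq_bigr => p _; rewrite E mulr_sumr.
under eq_bigr do rewrite mulr_suml.
rewrite exchange_big; apply: eq_bigr => q _; rewrite mulr_sumr.
by apply: eq_bigr => r _; rewrite basis_mul_cycle -!mulrA; congr (_ * (_ * _)); rewrite mulrC.
Qed.
End Incip.

(** * Functoriality under injections of index sets *)

Section Embedding.
Variables (K : fieldType) (n1 n2 : nat) (h : 'I_n1 -> 'I_n2).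
Hypothesis h_inj : injective h.

Fact point_map_subproof (p : point n1) : #|h @: val p| == 2%N.
Proof. by rewrite card_imset // (valP p). Qed.
Definition point_map (p : point n1) : point n2 :=
  exist _ (h @: val p) (point_map_subproof p).

Definition incemb_fun (x : incalg K n1) : incalg K n2 :=
  \sum_p x p *: basis_e K (h @: val p).

Fact incemb_is_linear : linear incemb_fun.
Proof.
move=> a x y; rewrite /incemb_fun scaler_sumr -big_split; apply: eq_bigr => p _.
by rewrite !ffunE scalerDl scalerA.
Qed.
HB.instance Definition _ := GRing.isLinear.Build K (incalg K n1) (incalg K n2)
  *:%R incemb_fun incemb_is_linear.

Definition incemb : 'Hom(incalg K n1, incalg K n2) := linfun incemb_fun.

Lemma incembE x : incemb x = \sum_p x p *: basis_e K (h @: val p).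
Proof. by rewrite lfunE. Qed.

(** Lets later formulas for images and products range over all sets without a cardinality
    hypothesis: outside the 2-subsets both sides vanish. *)
Lemma basis_e_eq0 n (s : {set 'I_n}) : #|s| != 2%N -> basis_e K s = 0.
Proof.
move=> cs; apply/ffunP=> p; rewrite !ffunE; case: eqP => // ps.
by rewrite -ps (valP p) in cs.
Qed.

Lemma incemb_basis s : incemb (basis_e K s) = basis_e K (h @: s).
Proof.
rewrite incembE; have [cs|cs] := boolP (#|s| == 2%N); last first.
  rewrite (basis_e_eq0 cs) basis_e_eq0 ?card_imset //.
  by rewrite big1 // => p _; rewrite ffunE scale0r.
pose p : point n1 := exist _ s cs.
rewrite (bigD1 p) //= big1 ?addr0 => [|q /negPf nqp].
  by rewrite ffunE eqxx scale1r.
by rewrite ffunE -[s]/(val p) (inj_eq val_inj) nqp scale0r.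
Qed.

Lemma incemb_point_map x p : incemb x (point_map p) = x p.
Proof.
rewrite incembE sum_ffunE (bigD1 p) //= big1 ?addr0 => [|q /negPf nqp].
  by rewrite !ffunE eqxx; apply: mulr1.
by rewrite !ffunE /= (inj_eq (imset_inj h_inj)) (inj_eq val_inj) eq_sym nqp; apply: mulr0.
Qed.

Lemma incemb_inj : injective incemb.
Proof.
by move=> x y exy; apply/ffunP=> p; rewrite -!incemb_point_map exy.
Qed.

(** By bilinearity two points p and q suffice. As h is injective, the image of p :|: q is a 3-set
    exactly when p :|: q is, so the two sums over blocks are both empty or both have one term, and
    images commute with intersections and differences. *)
Lemma incemb_mul (d1 : decoration n1) (d2 : decoration n2) :
    (forall (b1 : block n1) (b2 : block n2), val b2 = h @: val b1 -> d2 b2 = d1 b1) ->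
  forall x y, incemb (incmul d1 x y) = incmul d2 (incemb x) (incemb y).
Proof.
move=> hd x y; rewrite [incemb x]incembE [incemb y]incembE linear_sum.
rewrite linear_sumlz; apply: eq_bigr => p _.
rewrite linear_sum linear_sumr; apply: eq_bigr => q _ /=.
rewrite linearZ linearZlr /= -[h @: val p]/(val (point_map p)).
rewrite -[h @: val q]/(val (point_map q)) incmul_basisE scalerA; congr (_ *: _).
rewrite /basis_mul linear_sum /= -imsetU.
have [c3|c3] := boolP (#|val p :|: val q| == 3%N); last first.
  rewrite !big1 // => c /eqP cE; case/negP: c3; last by rewrite -cE (valP c).
  by rewrite -(card_imset _ h_inj) -cE (valP c).
have c3' : #|h @: (val p :|: val q)| == 3%N by rewrite card_imset.
pose b1 : block n1 := exist _ (val p :|: val q) c3.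
pose b2 : block n2 := exist _ (h @: (val p :|: val q)) c3'.
rewrite (eq_bigl (pred1 b1)) => [|c]; last by rewrite -(inj_eq val_inj).
rewrite [RHS](eq_bigl (pred1 b2)) => [|c]; last by rewrite -(inj_eq val_inj).
rewrite !big_pred1_eq linearZ /= incemb_basis (hd b1 b2) //=; congr (_ *: basis_e _ _).
rewrite -imsetI; last by move=> ? ? _ _; apply: h_inj.
apply/setP=> t; apply/imsetP/setDP=> [[s /setDP[su sI] ->]|[/imsetP[s su ->] sI]].
  by rewrite !mem_imset.
by exists s => //; apply/setDP; rewrite mem_imset in sI.
Qed.

End Embedding.

(** * Polar algebras and the algebra M(R^2) *)

Section PolarTransport.
Variable R : realType.

Lemma polar_from_polar (V : vectType R) (mul : V -> V -> V) (ip : V -> V -> R)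
    (U : {vspace V}) (W : vectType R) (ipW : W -> W -> R) (q : nat)
    (P : 'I_q -> 'End(W)) :
  polar_from mul ip U ipW P -> polar_algebra mul ip U.
Proof. by case=> metr [A0 [A1 [z [u [grad _ _ _]]]]]; split=> //; exists A0, A1. Qed.

Variables (V1 V2 : vectType R) (f : 'Hom(V1, V2)).
Variables (mul1 : V1 -> V1 -> V1) (mul2 : V2 -> V2 -> V2).
Variables (ip1 : V1 -> V1 -> R) (ip2 : V2 -> V2 -> R).
Hypothesis f_inj : injective f.
Hypothesis f_mul : forall x y, f (mul1 x y) = mul2 (f x) (f y).
Hypothesis f_ip : forall x y, ip2 (f x) (f y) = ip1 x y.

Lemma metrized_algebra_img U :
  metrized_algebra mul1 ip1 U -> metrized_algebra mul2 ip2 (f @: U)%VS.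
Proof.
have f_lin a x y : a *: f x + f y = f (a *: x + y) by rewrite linearP.
case=> [[clos comm lin] [sym ilin pos] assoc]; split; [split|split|].
- move=> _ _ /memv_imgP[x xU ->] /memv_imgP[y yU ->].
  by rewrite -f_mul memv_img // clos.
- move=> _ _ /memv_imgP[x xU ->] /memv_imgP[y yU ->].
  by rewrite -!f_mul comm.
- move=> a _ _ _ /memv_imgP[x xU ->] /memv_imgP[y yU ->] /memv_imgP[z zU ->].
  by rewrite f_lin -!f_mul lin // f_lin.
- move=> _ _ /memv_imgP[x xU ->] /memv_imgP[y yU ->].
  by rewrite !f_ip sym.
- move=> a _ _ _ /memv_imgP[x xU ->] /memv_imgP[y yU ->] /memv_imgP[z zU ->].
  by rewrite f_lin !f_ip ilin.
- move=> _ /memv_imgP[x xU ->] fx0; rewrite f_ip pos //.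
  by apply: contraNneq fx0 => ->; rewrite linear0.
- move=> _ _ _ /memv_imgP[x xU ->] /memv_imgP[y yU ->] /memv_imgP[z zU ->].
  by rewrite -!f_mul !f_ip assoc.
Qed.

(** Allows the polar structure to be checked once, in coordinates on M(R^2), and then carried into
    the incidence algebra by an injective isometric homomorphism. *)
Lemma polar_from_img U (W : vectType R) (ipW : W -> W -> R) (q : nat)
    (P : 'I_q -> 'End(W)) :
  polar_from mul1 ip1 U ipW P -> polar_from mul2 ip2 (f @: U)%VS ipW P.
Proof.
case=> metr [A0 [A1 [z [u [grad [zb zo] [uA1 uip] uP]]]]].
split; first exact: metrized_algebra_img.
have kf : lker f == 0%VS by apply/lker0P.
exists (f @: A0)%VS, (f @: A1)%VS, (map_tuple f z), (f \o u)%VF; split.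
- case: grad => sumU /directv_addP dir orth m00 m01 m11 sq; split.
  + by rewrite sumU limgD.
  + by apply/directv_addP; rewrite -lker0_img_cap // dir limg0.
  + by move=> _ _ /memv_imgP[x xA ->] /memv_imgP[y yA ->]; rewrite f_ip orth.
  + move=> _ _ /memv_imgP[x xA ->] /memv_imgP[y yA ->].
    by rewrite -f_mul m00 // linear0.
  + move=> _ _ /memv_imgP[x xA ->] /memv_imgP[y yA ->].
    by rewrite -f_mul memv_img // m01.
  + move=> _ _ /memv_imgP[x xA ->] /memv_imgP[y yA ->].
    by rewrite -f_mul memv_img // m11.
  + move=> _ _ /memv_imgP[x xA ->] /memv_imgP[y yA ->].
    by rewrite -!f_mul sq // f_ip linearZ.
- split; first by apply: limg_basis_of; rewrite // (eqP kf) capv0.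
  by move=> s t; rewrite !tnth_map f_ip.
- split; first by rewrite limg_comp uA1.
  by move=> x y; rewrite !comp_lfunE f_ip.
- by move=> s x; rewrite tnth_map !comp_lfunE -f_mul uP.
Qed.

End PolarTransport.

Lemma sum_I2 (V : nmodType) (F : 'I_2 -> V) : \sum_i F i = F 0 + F 1.
Proof. by rewrite big_ord_recl big_ord1; congr (_ + F _); apply/val_inj. Qed.

Lemma I2P (k : 'I_2) : k = 0 \/ k = 1.
Proof. by case: k => -[|[|//]] ?; [left|right]; apply/val_inj. Qed.

Section MalgR2.
Variable R : realType.
Local Notation M := (Malg R 2).

Lemma Malg2_linE a (u v : M) :
  (forall k l, (a *: u + v).1 k l = a * u.1 k l + v.1 k l) *
  (forall k l, vsval (a *: u + v).2 k l = a * vsval u.2 k l + vsval v.2 k l).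
Proof. by split=> k l; rewrite /= !mxE. Qed.

(** A symmetric 2x2 matrix with zero diagonal is a multiple of the swap matrix S, so its entry (0,
    1) is its only coordinate. *)
Lemma Malg2P (u v : M) : u.1 0 0 = v.1 0 0 -> u.1 1 0 = v.1 1 0 ->
  vsval u.2 0 1 = vsval v.2 0 1 -> u = v.
Proof.
case: u v => [x X] [y Y] /= e0 e1 e2.
congr pair.
  by apply/matrixP=> k l; rewrite (ord1 l); case: (I2P k) => ->.
have [/mem_sym0P[sX dX] /mem_sym0P[sY dY]] := (subvsP X, subvsP Y).
apply/val_inj/matrixP=> k l /=.
case: (I2P k) (I2P l) => -> [] ->; rewrite ?dX ?dY //.
by rewrite sX sY.
Qed.

(** For X = s S and Y = t S, the matrix XY + YX = 2 s t Id is diagonal and killed by pi. Hence the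
    two unit vectors and S have square zero, and the product of two of them is minus the third. *)
Lemma Mmul2_coord (u v : M) :
  [/\ (Mmul u v).1 0 0 = - (vsval u.2 0 1 * v.1 1 0) - vsval v.2 0 1 * u.1 1 0,
      (Mmul u v).1 1 0 = - (vsval u.2 0 1 * v.1 0 0) - vsval v.2 0 1 * u.1 0 0 &
      vsval (Mmul u v).2 0 1 = - (u.1 0 0 * v.1 1 0) - v.1 0 0 * u.1 1 0].
Proof.
have [/mem_sym0P[sX dX] /mem_sym0P[sY dY]] := (subvsP u.2, subvsP v.2).
rewrite Mmul2E /Mmul /Mmul_mx /= !mxE !sum_I2 !big_ord1 !mxE !dX !dY.
rewrite (sX 1 0) (sY 1 0).
by split; ring.
Qed.

(** Since tr(S S) = 2, the factor 1/2 makes S a unit vector. *)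
Lemma Mip2_coord (u v : M) :
  Mip u v = u.1 0 0 * v.1 0 0 + u.1 1 0 * v.1 1 0 + vsval u.2 0 1 * vsval v.2 0 1.
Proof.
have [/mem_sym0P[sX dX] /mem_sym0P[sY dY]] := (subvsP u.2, subvsP v.2).
rewrite /Mip /mxtrace !sum_I2 !mxE !sum_I2 !mxE !dX !dY.
rewrite (sX 1 0) (sY 1 0); lra.
Qed.

Lemma Mmul2_metrized : metrized_algebra (@Mmul R 2) (@Mip R 2) fullv.
Proof.
split; [split|split|].
- by move=> *; apply: memvf.
- move=> u v _ _; have [e0 e1 e2] := Mmul2_coord u v.
  have [e0' e1' e2'] := Mmul2_coord v u.
  by apply: Malg2P; rewrite ?(e0, e1, e2) ?(e0', e1', e2') ; ring.
- move=> a u v x _ _ _; have [e0 e1 e2] := Mmul2_coord (a *: u + v) x.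
  have [e0' e1' e2'] := Mmul2_coord u x; have [e0'' e1'' e2''] := Mmul2_coord v x.
  apply: Malg2P; rewrite ?(e0, e1, e2) !Malg2_linE.
  + by rewrite e0' e0''; ring.
  + by rewrite e1' e1''; ring.
  + by rewrite e2' e2''; ring.
- by move=> u v _ _; rewrite !Mip2_coord; ring.
- by move=> a u v x _ _ _; rewrite !Mip2_coord !Malg2_linE; ring.
- move=> u _ u0; rewrite Mip2_coord -!expr2.
  have ge0 := (sqr_ge0 (u.1 0 0), sqr_ge0 (u.1 1 0), sqr_ge0 (vsval u.2 0 1)).
  rewrite lt_neqAle !addr_ge0 ?ge0 // andbT eq_sym.
  apply: contraNN u0; rewrite !paddr_eq0 ?addr_ge0 ?ge0 // !sqrf_eq0.
  case/andP=> /andP[/eqP e0 /eqP e1] /eqP e2.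
  by apply/eqP/Malg2P; rewrite ?(e0, e1, e2) /= ?mxE.
(* In coordinates, the inner product of uv with x is minus the sum of u_r v_s x_t over all
   permutations (r, s, t) of the three coordinates, which is symmetric in u, v, x. *)
- move=> u v x _ _ _; rewrite !Mip2_coord.
  have [-> -> ->] := Mmul2_coord u v; have [-> -> ->] := Mmul2_coord v x; ring.
Qed.

Definition swap2 : 'M[R]_2 := \matrix_(i < 2, j < 2) (i != j)%:R.

Lemma swap2_sym0 : swap2 \in sym0 R 2.
Proof.
apply/mem_sym0P; split=> i; last by rewrite mxE eqxx.
by move=> j; rewrite !mxE eq_sym.
Qed.

Lemma clifford_R2_coord s (x : 'cV[R]_2) :
  clifford_R2 R s x 0 0 = x 1 0 /\ clifford_R2 R s x 1 0 = x 0 0.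
Proof.
by rewrite lfunE /= !mxE !sum_I2 !mxE !eqxx !mul0r mul1r add0r addr0 mul1r.
Qed.

Lemma cV2P (x y : 'cV[R]_2) : x 0 0 = y 0 0 -> x 1 0 = y 1 0 -> x = y.
Proof.
move=> e0 e1; apply/matrixP=> k l; rewrite (ord1 l).
by case: (I2P k) => ->.
Qed.

End MalgR2.

Section MalgR2polar.
Variable R : realType.
Local Notation M := (Malg R 2).

Lemma dot2 (x y : 'cV[R]_2) : dot x y = x 0 0 * y 0 0 + x 1 0 * y 1 0.
Proof. by rewrite /dot !mxE sum_I2 !mxE. Qed.

Lemma sym_clifford_system_R2 : sym_clifford_system (@dot R 2) (@clifford_R2 R).
Proof.
split; first split.
- by move=> x y _ _; rewrite !dot2; ring.
- by move=> a x y z _ _ _; rewrite !dot2 !mxE; ring.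
- move=> x _ x0; rewrite dot2 -!expr2.
  have ge0 := (sqr_ge0 (x 0 0), sqr_ge0 (x 1 0)).
  rewrite lt_neqAle !addr_ge0 ?ge0 // andbT eq_sym.
  apply: contraNN x0; rewrite !paddr_eq0 ?ge0 // !sqrf_eq0.
  by case/andP=> /eqP e0 /eqP e1; apply/eqP/cV2P; rewrite mxE.
- move=> s x y; rewrite !dot2.
  have [-> ->] := clifford_R2_coord s x; have [-> ->] := clifford_R2_coord s y.
  ring.
- move=> s t x; rewrite (ord1 s) (ord1 t) eqxx mulr1.
  set P := clifford_R2 R 0.
  have [e0 e1] := clifford_R2_coord 0 (P x); have [f0 f1] := clifford_R2_coord 0 x.
  by apply: cV2P; rewrite !mxE ?e0 ?e1 ?f0 ?f1; ring.
Qed.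

Definition Malg_vec (x : 'cV[R]_2) : M := (x, 0).
Fact Malg_vec_is_linear : linear Malg_vec.
Proof. by move=> a x y; apply: injective_projections; rewrite /= ?scaler0 ?addr0. Qed.
HB.instance Definition _ := GRing.isLinear.Build R 'cV[R]_2 M *:%R
  Malg_vec Malg_vec_is_linear.

Definition Malg_mx : M := (0, vsproj (sym0 R 2) (- swap2 R)).

Lemma Malg_mx_coord :
  [/\ Malg_mx.1 0 0 = 0, Malg_mx.1 1 0 = 0 & vsval Malg_mx.2 0 1 = -1].
Proof. by rewrite vsprojK ?memvN ?swap2_sym0 //= !mxE. Qed.

(* The sign of the generator z = (0, -S) of A_0, S being the swap matrix, makes
   z act on R^2 as S itself, since (0, X)(y, 0) = (- X y, 0). *)
Lemma Mmul2_polar_from :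
  polar_from (@Mmul R 2) (@Mip R 2) fullv (@dot R 2) (@clifford_R2 R).
Proof.
split; first exact: Mmul2_metrized.
pose u := linfun Malg_vec; have [z0 z1 z2] := Malg_mx_coord.
set z := Malg_mx in z0 z1 z2.
have uE x : [/\ (u x).1 0 0 = x 0 0, (u x).1 1 0 = x 1 0 & vsval (u x).2 0 1 = 0].
  by rewrite lfunE /= mxE.
have zE k : [/\ (k *: z).1 0 0 = 0, (k *: z).1 1 0 = 0 &
    vsval (k *: z).2 0 1 = - k].
  by rewrite -[k *: z]addr0 !Malg2_linE z0 z1 z2 /= !mxE; split; ring.
have zz : Mip z z = 1 by rewrite Mip2_coord z0 z1 z2; ring.
have zn0 : z != 0.
  by apply/eqP=> zeq0; move: z2; rewrite zeq0 /= mxE; lra.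
exists <[z]>%VS, (limg u), [tuple z], u; split.
- split.
  + apply/vspaceP=> x; rewrite memvf; apply/esym.
    (* The minus sign comes from z = (0, -S). *)
    have -> : x = - vsval x.2 0 1 *: z + u x.1.
      have [k0 k1 k2] := zE (- vsval x.2 0 1); have [e0 e1 e2] := uE x.1.
      apply: Malg2P; rewrite -[u x.1]scale1r addrC !Malg2_linE.
      * by rewrite k0 e0; ring.
      * by rewrite k1 e1; ring.
      * by rewrite k2 e2; ring.
    by rewrite memv_add ?memvZ ?memv_line ?memv_img ?memvf.
  + apply/directv_addP/eqP; rewrite -subv0; apply/subvP=> _ /memv_capP[/vlineP[k ->]].
    case/memv_imgP=> x _ kz; rewrite memv0; apply/eqP.
    have [k0 k1 k2] := zE k; have [e0 e1 e2] := uE x.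
    suff -> : k = 0 by rewrite scale0r.
    by move: k2; rewrite kz e2; lra.
  + move=> _ _ /vlineP[k ->] /memv_imgP[x _ ->]; rewrite Mip2_coord.
    have [-> -> ->] := zE k; have [-> -> ->] := uE x; ring.
  + move=> _ _ /vlineP[k ->] /vlineP[l ->].
    have [e0 e1 e2] := Mmul2_coord (k *: z) (l *: z).
    have [k0 k1 k2] := zE k; have [l0 l1 l2] := zE l.
    apply: Malg2P; rewrite ?e0 ?e1 ?e2 ?k0 ?k1 ?k2 ?l0 ?l1 ?l2 /= ?mxE; ring.
  + move=> _ _ /vlineP[k ->] /memv_imgP[x _ ->].
    (* Here (0, -k S)(x, 0) = (k S x, 0). *)
    apply/memv_imgP; exists (k *: clifford_R2 R 0 x); rewrite ?memvf //.
    have [e0 e1 e2] := Mmul2_coord (k *: z) (u x).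
    have [k0 k1 k2] := zE k; have [x0 x1 x2] := uE x.
    have [c0 c1] := clifford_R2_coord 0 x.
    have [y0 y1 y2] := uE (k *: clifford_R2 R 0 x).
    apply: Malg2P; rewrite ?e0 ?e1 ?e2 ?k0 ?k1 ?k2 ?x0 ?x1 ?x2 ?y0 ?y1 ?y2 ?mxE ?c0 ?c1;
      ring.
  + move=> _ _ /memv_imgP[x _ ->] /memv_imgP[y _ ->].
    (* The coefficient is the off-diagonal entry of x y^T + y x^T. The product is minus this
       multiple of S, that is, this multiple of z. *)
    apply/vlineP; exists (x 0 0 * y 1 0 + y 0 0 * x 1 0).
    have [e0 e1 e2] := Mmul2_coord (u x) (u y).
    have [x0 x1 x2] := uE x; have [y0 y1 y2] := uE y.
    have [k0 k1 k2] := zE (x 0 0 * y 1 0 + y 0 0 * x 1 0).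
    apply: Malg2P; rewrite ?e0 ?e1 ?e2 ?k0 ?k1 ?k2 ?x0 ?x1 ?x2 ?y0 ?y1 ?y2; ring.
  + move=> _ _ /vlineP[k ->] /memv_imgP[x _ ->].
    have [e0 e1 e2] := Mmul2_coord (k *: z) (Mmul (k *: z) (u x)).
    have [f0 f1 f2] := Mmul2_coord (k *: z) (u x).
    have [k0 k1 k2] := zE k; have [x0 x1 x2] := uE x.
    rewrite Mip2_coord k0 k1 k2 -[_ *: u x]addr0.
    apply: Malg2P; rewrite Malg2_linE ?e0 ?e1 ?e2 ?f0 ?f1 ?f2 ?k0 ?k1 ?k2 ?x0 ?x1 ?x2
      /= ?mxE; ring.
- split; first exact: seq1_basis.
  by move=> s t; rewrite (ord1 s) (ord1 t) eqxx.
- split=> // x y; rewrite Mip2_coord dot2.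
  have [-> -> ->] := uE x; have [-> -> ->] := uE y; ring.
- move=> s x; rewrite (ord1 s) (tnth_nth 0) /=.
  have [e0 e1 e2] := Mmul2_coord z (u x).
  have [x0 x1 x2] := uE x; have [c0 c1] := clifford_R2_coord 0 x.
  have [y0 y1 y2] := uE (clifford_R2 R 0 x).
  apply: Malg2P; rewrite ?e0 ?e1 ?e2 ?y0 ?y1 ?y2 ?c0 ?c1 ?x0 ?x1 ?x2 ?z0 ?z1 ?z2; ring.
Qed.

End MalgR2polar.

(** * Blocks and the embedding of M(R^2) *)

Section Combinatorics.
Variable n : nat.
Implicit Types (i j k : 'I_n) (s t : {set 'I_n}).

Lemma set3_uniq (b : block n) i j k :
  val b = [set i; j; k] -> [/\ i != j, i != k & j != k].
Proof.
move=> bE; have := valP b; rewrite bE setUC !cardsU1 cards1 !inE.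
by rewrite (eq_sym k) (eq_sym k); do !case: eqP.
Qed.

Lemma block_set3 i j k : i != j -> i != k -> j != k ->
  {b : block n | val b = [set i; j; k]}.
Proof.
move=> nij nik njk; suff c3 : #|[set i; j; k]| == 3%N.
  by exists (exist _ [set i; j; k] c3).
by rewrite setUC !cardsU1 cards1 !inE negb_or !(eq_sym k) nij nik njk.
Qed.

(** Reads off the parity of a point: it is even when both or neither of its elements lie in the
    block, and odd when exactly one does. *)
Lemma card_set2I i j s : i != j ->
  #|[set i; j] :&: s| = ((i \in s) + (j \in s))%N.
Proof.
move=> nij; rewrite -sum1_card (eq_bigl (fun k => (k \in [set i; j]) && (k \in s))).
  rewrite big_mkcondr /= big_setU1 ?inE //= big_set1.
  by do 2!case: (_ \in s).
by move=> k; rewrite inE.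
Qed.

Lemma subset_set3 (p : point n) i j k :
  (val p \subset [set i; j; k]) =
  (val p \in [:: [set i; j]; [set i; k]; [set j; k]]).
Proof.
have /cards2P[x [y [nxy pE]]] := valP p; rewrite pE.
apply/idP/idP => [|]; last first.
  by rewrite !inE => /or3P[] /eqP->; apply/subsetP=> z; rewrite !inE;
     case/orP=> ->; rewrite ?orbT.
rewrite subUset !sub1set !inE -!orbA => /andP[].
case/or3P=> /eqP xE /or3P[] /eqP yE; move: nxy; rewrite xE yE ?eqxx // => _;
  by rewrite ?orbT // setUC eqxx ?orbT.
Qed.
End Combinatorics.

Section Products.
Variables (K : fieldType) (n : nat) (d : decoration n).
Local Notation e := (basis_e K).

Lemma incmul_same (s : {set 'I_n}) : incmul d (e s) (e s) = 0.
Proof.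
have [cs|cs] := boolP (#|s| == 2%N); last by rewrite basis_e_eq0 // linear0r.
exact: (incmul_basis_same K d (exist _ s cs)).
Qed.

Lemma incmul_disjoint (s t : {set 'I_n}) :
  s :&: t = set0 -> incmul d (e s) (e t) = 0.
Proof.
have [cs|cs] := boolP (#|s| == 2%N); last by rewrite basis_e_eq0 // linear0l.
have [ct|ct] := boolP (#|t| == 2%N).
  exact: (@incmul_basis_disjoint K n d (exist _ s cs) (exist _ t ct)).
by rewrite (basis_e_eq0 _ ct) linear0r.
Qed.

Lemma incmul_star (w i j k : 'I_n) : i != j -> i != k -> j != k ->
  incmul (star_dec w) (e [set i; j]) (e [set i; k]) =
    (-1) ^+ (w \in [set i; j; k]) *: e [set j; k].
Proof.
move=> nij nik njk; have [b bE] := block_set3 nij nik njk.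
by rewrite (incmul_basis K (star_dec w) bE) /star_dec bE.
Qed.

Lemma comm_algebra_incmul (U : {vspace incalg K n}) :
  {in U &, forall x y, incmul d x y \in U} -> comm_algebra (incmul d) U.
Proof.
move=> clos; split=> // [x y _ _|a x y z _ _ _]; first exact: incmulC.
by rewrite linearPl.
Qed.

End Products.

Section Malg_embedding.
Variables (R : realType) (V : vectType R) (e1 e2 e3 : V).

(** The vectors e1, e2, e3 are the images of the two unit vectors of R^2 and of the swap matrix. *)
Definition Malg_emb_fun (u : Malg R 2) : V :=
  u.1 0 0 *: e1 + u.1 1 0 *: e2 + vsval u.2 0 1 *: e3.
Fact Malg_emb_is_linear : linear Malg_emb_fun.
Proof.
move=> a u v; rewrite /Malg_emb_fun !Malg2_linE !scalerDl !scalerDr !scalerA.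
by rewrite [RHS]addrACA; congr (_ + _); rewrite addrACA.
Qed.
HB.instance Definition _ := GRing.isLinear.Build R (Malg R 2) V *:%R
  Malg_emb_fun Malg_emb_is_linear.
Definition Malg_emb : 'Hom(Malg R 2, V) := linfun Malg_emb_fun.

Lemma Malg_embE u :
  Malg_emb u = u.1 0 0 *: e1 + u.1 1 0 *: e2 + vsval u.2 0 1 *: e3.
Proof. by rewrite lfunE. Qed.

Lemma Malg_mk (a b c : R) : exists u : Malg R 2,
  [/\ u.1 0 0 = a, u.1 1 0 = b & vsval u.2 0 1 = c].
Proof.
exists ((\col_k (if k == 0 then a else b)), vsproj (sym0 R 2) (c *: swap2 R)).
by rewrite vsprojK ?memvZ ?swap2_sym0 //= !mxE !mulr1.
Qed.

Lemma Malg_emb_limg : limg Malg_emb = <<[:: e1; e2; e3]>>%VS.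
Proof.
apply/vspaceP=> x; apply/memv_imgP/idP=> [[u _ ->]|].
  by rewrite Malg_embE !memvD ?memvZ // memv_span // !inE eqxx ?orbT.
rewrite !span_cons span_nil addv0.
case/memv_addP=> _ /vlineP[a ->] [_ /memv_addP[_ /vlineP[b ->] [_ /vlineP[c ->] ->]] ->].
have [u [u1 u2 u3]] := Malg_mk a b c.
by exists u; rewrite ?memvf // Malg_embE u1 u2 u3 addrA.
Qed.

End Malg_embedding.

Section Malg_to_incalg.
Variables (R : realType) (n : nat) (d : decoration n).
Variables e1 e2 e3 : incalg R n.
Local Notation mul := (incmul d).
Local Notation f := (Malg_emb e1 e2 e3).

(** The hypotheses repeat the multiplication table of M(R^2) given by [Mmul2_coord]; bilinearity and
    commutativity do the rest. *)
Lemma Malg_emb_mul :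
    mul e1 e1 = 0 -> mul e2 e2 = 0 -> mul e3 e3 = 0 ->
    mul e1 e2 = - e3 -> mul e1 e3 = - e2 -> mul e2 e3 = - e1 ->
  forall u v, f (Mmul u v) = mul (f u) (f v).
Proof.
move=> e11 e22 e33 e12 e13 e23 u v; rewrite !Malg_embE.
have [-> -> ->] := Mmul2_coord u v.
rewrite !(linearDl, linearDr) /= !linearZlr /= (incmulC _ e2 e1).
rewrite (incmulC _ e3 e1) (incmulC _ e3 e2) e11 e12 e13 e22 e23 e33.
apply/ffunP=> p; rewrite !ffunE /GRing.scale /=; ring.
Qed.

Lemma Malg_emb_ip :
    incip e1 e1 = 1 -> incip e2 e2 = 1 -> incip e3 e3 = 1 ->
    incip e1 e2 = 0 -> incip e1 e3 = 0 -> incip e2 e3 = 0 ->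
  forall u v, incip (f u) (f v) = Mip u v.
Proof.
move=> e11 e22 e33 e12 e13 e23 u v; rewrite !Malg_embE Mip2_coord.
rewrite !(linearDl, linearDr) /= !linearZlr /= (incipC e2 e1).
rewrite (incipC e3 e1) (incipC e3 e2) e11 e12 e13 e22 e23 e33; ring.
Qed.

End Malg_to_incalg.

(** * The even part with respect to a block *)

Section EvenPart.
Variables (R : realType) (m : nat) (w i j : 'I_m) (b : block m).
Hypothesis bE : val b = [set w; i; j].
Local Notation e := (basis_e R).
Local Notation mul := (@incmul R m (star_dec w)).
Local Notation e1 := (e [set w; i]).
Local Notation e2 := (e [set w; j]).
Local Notation e3 := (e [set i; j]).
Local Notation Aplus := (even_part R b).

Let nwi : w != i. Proof. by have [] := set3_uniq bE. Qed.
Let nwj : w != j. Proof. by have [] := set3_uniq bE. Qed.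
Let nij : i != j. Proof. by have [] := set3_uniq bE. Qed.

Let niw : i != w. Proof. by rewrite eq_sym. Qed.
Let njw : j != w. Proof. by rewrite eq_sym. Qed.
Let nji : j != i. Proof. by rewrite eq_sym. Qed.

Lemma block_pointP (p : point m) : val p \subset val b ->
  [\/ val p = [set w; i], val p = [set w; j] | val p = [set i; j]].
Proof.
rewrite bE subset_set3 !inE.
by case/or3P=> /eqP->; [constructor 1|constructor 2|constructor 3].
Qed.

Lemma star_mul_block :
  [/\ mul e1 e2 = - e3, mul e1 e3 = - e2 & mul e2 e3 = - e1].
Proof.
split.
- by rewrite incmul_star // !inE eqxx scaleN1r.
- by rewrite (setUC [set w]) incmul_star // !inE eqxx orbT scaleN1r.
- rewrite (setUC [set w]) (setUC [set i]) incmul_star //.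
  by rewrite !inE eqxx orbT scaleN1r.
Qed.

Lemma star_idem_block : block_idem R (star_dec w) b = - 2^-1 *: (e1 + e2 + e3).
Proof.
rewrite /block_idem /star_dec bE !inE eqxx mulrN1; congr (_ *: _).
have c2 (x y : 'I_m) : x != y -> #|[set x; y]| == 2%N by move=> nxy; rewrite cards2 nxy.
pose p1 : point m := exist _ [set w; i] (c2 w i nwi).
pose p2 : point m := exist _ [set w; j] (c2 w j nwj).
pose p3 : point m := exist _ [set i; j] (c2 i j nij).
rewrite (eq_bigl (mem [:: p1; p2; p3])) => [|p]; last first.
  by rewrite subset_set3 !inE.
rewrite -big_uniq /=; first by rewrite !big_cons big_nil addr0 addrA.
(* Summing over the list requires its three points to be distinct: in each pair, some element lies
   in one point and not in the other. *)
rewrite !inE -!(inj_eq val_inj) /= negb_or -!andbA andbT.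
have neq (s t : {set 'I_m}) x : x \in s -> x \notin t -> s != t.
  by move=> xs; apply: contraNneq => <-.
apply/and3P; split.
- by apply: (neq _ _ i); rewrite !inE ?eqxx ?orbT // negb_or eq_sym nwi.
- by apply: (neq _ _ w); rewrite !inE ?eqxx ?orbT // negb_or nwi.
- by apply: (neq _ _ w); rewrite !inE ?eqxx ?orbT // negb_or nwi.
Qed.

Local Notation c := (block_idem R (star_dec w) b).

(** On the span of the block, L(c) is (J - Id)/2 with J the all-ones matrix. This gives the
    eigenvalue 1 on e1 + e2 + e3 and -1/2 on the differences. *)
Lemma star_idem_mul_block :
  [/\ mul c e1 = 2^-1 *: (e2 + e3), mul c e2 = 2^-1 *: (e1 + e3) &
      mul c e3 = 2^-1 *: (e1 + e2)].
Proof.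
have [e12 e13 e23] := star_mul_block; rewrite star_idem_block.
rewrite !linearZl_LR /= !linearDl /= !incmul_same (incmulC _ e2 e1).
rewrite (incmulC _ e3 e1) (incmulC _ e3 e2) e12 e13 e23.
by split; apply/ffunP=> p; rewrite !ffunE /GRing.scale /=; ring.
Qed.

Lemma star_idem_mul_disjoint (s : {set 'I_m}) :
  s :&: val b = set0 -> mul c (e s) = 0.
Proof.
move=> sb0; have sub0 (t : {set 'I_m}) : t \subset val b -> t :&: s = set0.
  by move=> tb; apply/eqP; rewrite -subset0 -sb0 setIC setIS.
rewrite star_idem_block linearZl_LR /= !linearDl /= !incmul_disjoint ?addr0 ?scaler0 //;
  by apply: sub0; rewrite bE; apply/subsetP=> x; rewrite !inE;
     case/orP=> ->; rewrite ?orbT.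
Qed.

(** The blocks wik and wjk have sign -1 and ijk has sign 1. On this span L(c) therefore has
    eigenvalue -1 on e_wk - e_ik - e_jk and 1/2 on its orthogonal complement. *)
Lemma star_idem_mul_odd k : k \notin val b ->
  [/\ mul c (e [set w; k]) = 2^-1 *: (e [set i; k] + e [set j; k]),
      mul c (e [set i; k]) = 2^-1 *: (e [set w; k] - e [set j; k]) &
      mul c (e [set j; k]) = 2^-1 *: (e [set w; k] - e [set i; k])].
Proof.
rewrite bE !inE !negb_or -andbA => /and3P[nkw nki nkj].
have nwk : w != k by rewrite eq_sym.
have nik : i != k by rewrite eq_sym.
have njk : j != k by rewrite eq_sym.
have disj x y z t : x != z -> x != t -> y != z -> y != t ->
    mul (e [set x; y]) (e [set z; t]) = 0.
  move=> xz xt yz yt; apply: incmul_disjoint; apply/setP=> s; rewrite !inE.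
  by apply/negP=> /andP[/orP[] /eqP->]; apply/negP; rewrite negb_or; apply/andP.
have w_in x y : (-1) ^+ (w \in [set w; x; y]) = -1 :> R by rewrite !inE eqxx.
have w_in' x y : (-1) ^+ (w \in [set x; w; y]) = -1 :> R.
  by rewrite !inE eqxx orbT.
have w_notin x y : w != x -> w != y -> (-1) ^+ (w \in [set x; y; k]) = 1 :> R.
  by move=> nx ny; rewrite !inE (negPf nx) (negPf ny) (negPf nwk).
rewrite star_idem_block !linearZl_LR /= !linearDl /=; split.
- rewrite !incmul_star // (disj i j) // !w_in addr0.
  by apply/ffunP=> p; rewrite !ffunE /GRing.scale /=; ring.
- rewrite (setUC [set w] [set i]) !incmul_star // (disj w j) // w_in' w_notin //.
  by apply/ffunP=> p; rewrite !ffunE /GRing.scale /=; ring.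
- rewrite (setUC [set w] [set j]) (setUC [set i] [set j]) !incmul_star //.
  rewrite (disj w i) // w_in' w_notin //.
  by apply/ffunP=> p; rewrite !ffunE /GRing.scale /=; ring.
Qed.

Local Notation A := (@block_eigenspace R m (star_dec w) b).

Lemma mem_block_eigenspace (lam : R) x :
  (x \in A lam) = (mul c x == lam *: x).
Proof.
by rewrite memv_ker !lfunE /= opp_lfunE scale_lfunE id_lfunE incmul_opE subr_eq0.
Qed.

(* On the span of e_wk, e_ik, e_jk, k not in b, the eigenvalues of L(c) are -1
   and 1/2: a vector of A_lam has no such components for the other lam. *)
Lemma block_eigenspace_sub_even (lam : R) : lam != -1 -> lam != 2^-1 ->
  (A lam <= Aplus)%VS.
Proof.
move=> lam1 lam2; apply/subvP=> x; rewrite mem_block_eigenspace => /eqP cx.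
(* L(c) is self-adjoint, so the eigenvector equation becomes a linear system in the coordinates of
   x. *)
have xc y : lam * incip x y = incip x (mul c y).
  by rewrite -incip_incmulA (incmulC _ x) cx linearZl_LR.
have odd0 k : k \notin val b -> [/\ incip x (e [set w; k]) = 0,
    incip x (e [set i; k]) = 0 & incip x (e [set j; k]) = 0].
  move=> kb; have [cw ci cj] := star_idem_mul_odd kb.
  have := (xc (e [set w; k]), xc (e [set i; k]), xc (e [set j; k])).
  rewrite cw ci cj !linearZr_LR /= !linearDr !linearNr /=.
  set xw := incip x _; set xi := incip x _; set xj := incip x _.
  case=> [[ew ei] ej].
  have eig mu y : lam != mu -> lam * y = mu * y -> y = 0.
    move=> lam_mu /eqP; rewrite -subr_eq0 -mulrBl mulf_eq0 subr_eq0 (negPf lam_mu).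
    by move/eqP.
  (* Up to scaling, xw - xi - xj is the component of x along the eigenvector for -1. Once it
     vanishes, the system reduces to lam xi = xi/2 and lam xj = xj/2. *)
  have e : xw = xi + xj.
    by apply/eqP; rewrite -subr_eq0 opprD addrA; apply/eqP/(eig _ _ lam1); lra.
  have xi0 : xi = 0 by apply: (eig _ _ lam2); lra.
  have xj0 : xj = 0 by apply: (eig _ _ lam2); lra.
  by rewrite e xi0 xj0 addr0.
rewrite [x]incalg_basis_sum; apply: memv_suml => p _.
have [p_odd|p_even] := boolP (odd #|val p :&: val b|); last first.
  rewrite memvZ // memv_span //; apply/mapP; exists p => //.
  by rewrite mem_filter p_even mem_enum.
suff -> : x p = 0 by rewrite scale0r mem0v.
rewrite -incip_basis_e; have /cards2P[y [z [nyz pE]]] := valP p.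
move: p_odd; rewrite pE card_set2I // oddD !oddb.
have yes k l : k \notin val b -> l \in val b -> incip x (e [set l; k]) = 0.
  by move=> kb; have [xw xi xj] := odd0 k kb; rewrite bE !inE -orbA => /or3P[] /eqP->.
have [yb|yb] := boolP (y \in val b); have [zb|zb] := boolP (z \in val b) => // _.
  exact: yes.
by rewrite setUC yes.
Qed.

Lemma block_points_sub_eigenspaces :
  (<<[:: e1; e2; e3]>> <= A 1%R + A (- 2^-1))%VS.
Proof.
have [c1 c2 c3] := star_idem_mul_block.
have diff_in (u v t : incalg R m) : mul c u = 2^-1 *: (v + t) ->
    mul c v = 2^-1 *: (u + t) -> u - v \in A (- 2^-1).
  move=> cu cv; rewrite mem_block_eigenspace linearBr /= cu cv.
  by apply/eqP/ffunP=> p; rewrite !ffunE /GRing.scale /=; lra.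
have in_sum (u v t : incalg R m) : mul c u = 2^-1 *: (v + t) ->
    mul c v = 2^-1 *: (u + t) -> mul c t = 2^-1 *: (u + v) ->
    u \in (A 1%R + A (- 2^-1))%VS.
  move=> cu cv ct.
  (* The sum of the three points is an eigenvector for 1, and the differences are eigenvectors for
     -1/2. *)
  have -> : u = 3^-1 *: (u + v + t) + (3^-1 *: (u - v) + 3^-1 *: (u - t)).
    by apply/ffunP=> p; rewrite !ffunE /GRing.scale /=; lra.
  apply: memv_add; last first.
    by apply: memvD; apply: memvZ; [exact: diff_in cu cv|apply: (diff_in _ _ v); rewrite // addrC].
  apply: memvZ; rewrite mem_block_eigenspace !linearDr /= cu cv ct.
  by apply/eqP/ffunP=> p; rewrite !ffunE /GRing.scale /=; lra.
apply/span_subvP=> x; rewrite !inE => /or3P[] /eqP->.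
- exact: in_sum c1 c2 c3.
- by apply: in_sum c2 c1 _; rewrite (addrC e2).
- by apply: (in_sum _ e1 e2); rewrite // addrC.
Qed.

(** An even point lies either in the block, hence in A_1 + A_{-1/2}, or outside it, hence in A_0.
    Conversely, 1, -1/2 and 0 avoid the eigenvalues -1 and 1/2 of the odd part. Directness is the
    independence of eigenspaces for distinct eigenvalues. *)
Lemma even_part_decomposition :
  Aplus = (A 1%R + A (- 2^-1) + A 0%R)%VS /\ directv (A 1%R + A (- 2^-1) + A 0%R).
Proof.
split.
  have sub_even lam : lam \in [:: 1; - 2^-1; 0] -> (A lam <= Aplus)%VS.
    move=> lam_in; apply: block_eigenspace_sub_even; apply/eqP=> lamE;
      by move: lam_in; rewrite lamE !inE => /or3P[] /eqP; lra.
  apply/eqP; rewrite eqEsubv [X in _ && X]subv_add subv_add.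
  apply/andP; split; last first.
    apply/andP; split; last by apply: sub_even; rewrite !inE eqxx !orbT.
    by apply/andP; split; apply: sub_even; rewrite !inE eqxx ?orbT.
  apply/span_subvP=> v /mapP[p]; rewrite mem_filter => /andP[p_even _ ->{v}].
  have [sub|nsub] := boolP (val p \subset val b).
    apply: (subvP (addvSl _ _)); apply: (subvP block_points_sub_eigenspaces).
    by case: (block_pointP sub) => ->; apply: memv_span; rewrite !inE eqxx ?orbT.
  apply: (subvP (addvSr _ _)).
  rewrite mem_block_eigenspace star_idem_mul_disjoint ?scale0r //.
  have /cards2P[y [z [nyz pE]]] := valP p.
  apply: cards0_eq; move: p_even nsub; rewrite pE card_set2I // subUset !sub1set.
  by do 2!case: (_ \in _).
have mul_c x lam : x \in A lam -> mul c x = lam *: x.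
  by rewrite mem_block_eigenspace => /eqP.
have eig2 x y lam mu : lam != mu -> x = y -> mul c x = lam *: x ->
    mul c y = mu *: y -> x = 0.
  move=> lam_mu <- -> /eqP; rewrite -subr_eq0 -scalerBl scaler_eq0 subr_eq0.
  by rewrite (negPf lam_mu) => /eqP.
have dir12 : directv (A 1%R + A (- 2^-1)).
  apply/directv_addP/eqP; rewrite -subv0; apply/subvP=> x.
  case/memv_capP=> /mul_c x1 /mul_c x2; rewrite memv0; apply/eqP.
  by apply: (eig2 x x 1 (- 2^-1)) => //; apply/eqP; lra.
rewrite directv_addE /= dir12 directv_trivial /= -subv0.
apply/subvP=> _ /memv_capP[/memv_addP[x x1 [y y2 ->]]].
rewrite mem_block_eigenspace linearDr /= (mul_c _ _ x1) (mul_c _ _ y2) => /eqP xy.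
(* Applying L(c) to x + y in A_0 gives x - y/2 = 0. Thus y = 2x is an eigenvector for both 1 and
   -1/2, and vanishes. *)
have xE : x = 2^-1 *: y.
  move: xy; rewrite scale1r scale0r scaleNr => /eqP.
  by rewrite subr_eq0 => /eqP.
have y0 : y = 0.
  apply: (eig2 y y 1 (- 2^-1)) => //; first by apply/eqP; lra.
  + have -> : y = 2 *: x by rewrite xE scalerA divff ?pnatr_eq0 // scale1r.
    by rewrite linearZr_LR /= (mul_c _ _ x1) !scale1r.
  + exact: mul_c.
by rewrite xE y0 scaler0 addr0 mem0v.
Qed.
End EvenPart.

(** Exchanges the generators g, a1, a2 of the first factor for the three points of the block. The
    three generators add up to 3u, so u is recovered because 3 is invertible. *)
Lemma span_eigenbasis (R : realType) (V : vectType R) (u v t : V) :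
  <<[:: (u + v + t)%R; (u - v)%R; (u - t)%R]>>%VS = <<[:: u; v; t]>>%VS.
Proof.
apply/eqP; rewrite eqEsubv; apply/andP; split; apply/span_subvP=> x.
  by rewrite !inE => /or3P[] /eqP->; rewrite ?memvB ?memvD // memv_span // !inE eqxx ?orbT.
set U := (<<_>>)%VS.
have [s_in uv_in ut_in] : [/\ u + v + t \in U, u - v \in U & u - t \in U].
  by split; apply: memv_span; rewrite !inE eqxx ?orbT.
have u_in : u \in U.
  have -> : u = 3^-1 *: (u + v + t + (u - v) + (u - t)).
    rewrite (addrAC _ t) [u + v + _]addrACA subrr addr0.
    rewrite -[_ + t + _]addrA (addrC t) subrK.
    by rewrite -mulr2n -mulrSr -scaler_nat scalerA mulVf ?scale1r ?pnatr_eq0.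
  by apply: memvZ; apply: memvD => //; apply: memvD.
rewrite !inE => /or3P[] /eqP-> //.
  by rewrite -[v](subKr u) memvB.
by rewrite -[t](subKr u) memvB.
Qed.

(** * Indexing the elements outside a block *)

Section ComplementEmbedding.
Variables (n : nat) (b : block n).

Fact card_setC_block : (n - 3)%N = #|~: val b|.
Proof. by rewrite cardsCs setCK (eqP (valP b)) card_ord. Qed.

Definition outside_block (k : 'I_(n - 3)) : 'I_n :=
  enum_val (cast_ord card_setC_block k).

Lemma outside_block_inj : injective outside_block.
Proof. by move=> k l /enum_val_inj/cast_ord_inj. Qed.

Lemma outside_blockP k : outside_block k \notin val b.
Proof. by have := enum_valP (cast_ord card_setC_block k); rewrite inE. Qed.

Lemma outside_block_surj k : k \notin val b -> exists l, outside_block l = k.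
Proof.
move=> kb; have kC : k \in ~: val b by rewrite inE.
exists (cast_ord (esym card_setC_block) (enum_rank_in kC k)).
by rewrite /outside_block cast_ordKV enum_rankK_in.
Qed.

Lemma outside_block_disjoint (s : {set 'I_(n - 3)}) :
  (outside_block @: s) :&: val b = set0.
Proof.
apply/setP=> k; rewrite !inE; apply/negP=> /andP[/imsetP[l _ ->]].
by rewrite (negPf (outside_blockP l)).
Qed.

End ComplementEmbedding.

(** * Homomorphisms from a product of two algebras *)

Section ProductMap.
Variables (K : fieldType) (V1 V2 V : vectType K).
Variables (f1 : 'Hom(V1, V)) (f2 : 'Hom(V2, V)).

Definition pair_hom_fun (u : V1 * V2) : V := f1 u.1 + f2 u.2.
Fact pair_hom_is_linear : linear pair_hom_fun.
Proof. by move=> a u v; rewrite /pair_hom_fun !linearP scalerDr addrACA. Qed.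
HB.instance Definition _ := GRing.isLinear.Build K (V1 * V2)%type V *:%R
  pair_hom_fun pair_hom_is_linear.
Definition pair_hom : 'Hom((V1 * V2)%type, V) := linfun pair_hom_fun.

Lemma pair_homE u : pair_hom u = f1 u.1 + f2 u.2.
Proof. by rewrite lfunE. Qed.

Lemma pair_hom_limg : limg pair_hom = (limg f1 + limg f2)%VS.
Proof.
apply/vspaceP=> x; apply/memv_imgP/memv_addP.
  case=> u _ ->; exists (f1 u.1); first exact: memv_img (memvf _).
  by exists (f2 u.2); [exact: memv_img (memvf _)|exact: pair_homE].
case=> _ /memv_imgP[u _ ->] [_ /memv_imgP[v _ ->] ->].
by exists (u, v); rewrite ?memvf ?pair_homE.
Qed.

(** Directness of the sum of the images gives injectivity, and their mutual annihilation removes the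
    cross terms of a product. *)
Lemma pair_hom_alg_iso (mul1 : V1 -> V1 -> V1) (mul2 : V2 -> V2 -> V2)
    (mul : V -> V -> V) (B : {vspace V}) :
    injective f1 -> injective f2 ->
    (forall u v, f1 (mul1 u v) = mul (f1 u) (f1 v)) ->
    (forall u v, f2 (mul2 u v) = mul (f2 u) (f2 v)) ->
    (forall x y z, mul (x + y) z = mul x z + mul y z) ->
    (forall x y z, mul z (x + y) = mul z x + mul z y) ->
    direct_product mul B (limg f1) (limg f2) ->
  alg_iso (prod_mul mul1 mul2) mul pair_hom B.
Proof.
move=> inj1 inj2 mor1 mor2 mulDl mulDr [_ _ [BE dir] ort]; split.
- move=> u v; rewrite !pair_homE => euv.
  have /directv_add_unique/(_ _ _ _ _ (memv_img f1 (memvf u.1))) := dir.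
  move/(_ _ _ _ (memv_img f1 (memvf v.1)) (memv_img f2 (memvf u.2))).
  move/(_ _ (memv_img f2 (memvf v.2))); rewrite euv eqxx => /esym/eqP[e1 e2].
  by apply: injective_projections; [apply: inj1|apply: inj2].
- by rewrite pair_hom_limg BE.
- move=> u v; rewrite !pair_homE mulDl !mulDr /= mor1 mor2.
  have in1 x : f1 x \in limg f1 by rewrite memv_img ?memvf.
  have in2 x : f2 x \in limg f2 by rewrite memv_img ?memvf.
  have [-> _] := ort _ _ (in1 u.1) (in2 v.2).
  by have [_ ->] := ort _ _ (in1 v.1) (in2 u.2); rewrite addr0 add0r.
Qed.

End ProductMap.

(** * The two factors of the even part *)

Section Factors.
Variables (R : realType) (m : nat) (w i j : 'I_m) (b : block m).
Hypothesis bE : val b = [set w; i; j].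
Local Notation e := (basis_e R).
Local Notation mul := (@incmul R m (star_dec w)).
Local Notation e1 := (e [set w; i]).
Local Notation e2 := (e [set w; j]).
Local Notation e3 := (e [set i; j]).
Local Notation Aplus := (even_part R b).
Local Notation h := (@outside_block m b).
Local Notation f1 := (Malg_emb e1 e2 e3).
Local Notation f2 := (incemb R h).

Lemma block_factor_mul u v : f1 (Mmul u v) = mul (f1 u) (f1 v).
Proof.
have [e12 e13 e23] := star_mul_block R bE.
by apply: Malg_emb_mul; rewrite ?incmul_same.
Qed.

Lemma block_factor_ip u v : incip (f1 u) (f1 v) = Mip u v.
Proof.
have [nwi nwj nij] := set3_uniq bE.
have ip (s t : {set 'I_m}) : #|t| == 2%N -> incip (e s) (e t) = (s == t)%:R.
  move=> ct; rewrite -[t]/(val (exist (fun p : {set 'I_m} => #|p| == 2%N) t ct)).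
  by rewrite incip_basis_e ffunE eq_sym.
have neq (s t : {set 'I_m}) x : x \in s -> x \notin t -> s == t = false.
  by move=> xs xt; apply/negbTE; apply: contraNneq xt => <-.
have [cwi cwj cij] : [/\ #|[set w; i]| == 2%N, #|[set w; j]| == 2%N & #|[set i; j]| == 2%N].
  by rewrite !cards2 nwi nwj nij.
apply: Malg_emb_ip; rewrite ip // ?eqxx //.
- by rewrite (neq _ _ i) // !inE ?eqxx ?orbT // negb_or eq_sym nwi.
- by rewrite (neq _ _ w) // !inE ?eqxx ?orbT // negb_or nwi.
- by rewrite (neq _ _ w) // !inE ?eqxx ?orbT // negb_or nwi.
Qed.

(** An isometry from a positive definite space has trivial kernel. *)
Lemma block_factor_inj : injective f1.
Proof.
have [_ [_ _ pos] _] := Mmul2_metrized R.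
move=> u v euv; apply/eqP; rewrite -subr_eq0; apply: contraT => uv0.
have := pos (u - v) (memvf _) uv0.
by rewrite -block_factor_ip linearB /= euv subrr linear0r ltxx.
Qed.

(** The image of a block under [outside_block] is disjoint from b, so it avoids w and the star
    decoration gives it sign 1. *)
Lemma outside_factor_mul u v :
  f2 (incmul (@trivial_dec (m - 3)) u v) = mul (f2 u) (f2 v).
Proof.
apply: incemb_mul => [|b1 b2 b2E]; first exact: outside_block_inj.
have /setP/(_ w) := outside_block_disjoint b (val b1).
rewrite -b2E !inE bE !inE eqxx andbT => w_b2.
by rewrite /star_dec w_b2.
Qed.

Lemma even_part_sub : (Aplus <= limg f1 + limg f2)%VS.
Proof.
apply/span_subvP=> v /mapP[p]; rewrite mem_filter => /andP[p_even _ ->{v}].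
have [sub|nsub] := boolP (val p \subset val b).
  apply: (subvP (addvSl _ _)); rewrite Malg_emb_limg.
  by case: (block_pointP bE sub) => ->; apply: memv_span; rewrite !inE eqxx ?orbT.
apply: (subvP (addvSr _ _)).
have /cards2P[x [y [nxy pE]]] := valP p.
have : (x \notin val b) && (y \notin val b).
  move: p_even nsub; rewrite pE card_set2I // subUset !sub1set.
  by do 2!case: (_ \in _).
case/andP=> /outside_block_surj[x' xE] /outside_block_surj[y' yE].
apply/memv_imgP; exists (e [set x'; y']); rewrite ?memvf // incemb_basis.
  by rewrite imsetU1 imset_set1 xE yE pE.
exact: outside_block_inj.
Qed.

Lemma block_factor_outside u v : mul (f1 u) (f2 v) = 0.
Proof.
have disj x y (p : point (m - 3)) : x \in val b -> y \in val b ->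
    mul (e [set x; y]) (e (h @: val p)) = 0.
  move=> xb yb; apply: incmul_disjoint; apply/eqP; rewrite -subset0.
  by rewrite -(outside_block_disjoint b (val p)) setIC setIS // subUset !sub1set xb.
have [wb ib jb] : [/\ w \in val b, i \in val b & j \in val b].
  by rewrite bE !inE !eqxx ?orbT.
rewrite Malg_embE incembE linear_sumr big1 // => p _.
rewrite linearZr_LR /= !linearDl /= !linearZl_LR /= !disj //.
by rewrite !scaler0 !addr0 scaler0.
Qed.

Lemma outside_factor_sub : (limg f2 <= block_eigenspace (star_dec w) b 0%R)%VS.
Proof.
apply/subvP=> x /memv_imgP[v _ ->{x}]; rewrite incembE; apply: memv_suml => p _.
apply: memvZ; rewrite (mem_block_eigenspace w b) scale0r.
by rewrite (star_idem_mul_disjoint _ bE) ?outside_block_disjoint.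
Qed.

(** The first image lies in A_1 + A_{-1/2} and the second in A_0. By [even_part_decomposition] this
    places both in the even part and makes their sum direct. *)
Lemma even_part_direct_product : direct_product mul Aplus (limg f1) (limg f2).
Proof.
have f1_sub := block_points_sub_eigenspaces R bE.
rewrite -Malg_emb_limg in f1_sub.
have f2_sub := outside_factor_sub.
have [AE dirA] := even_part_decomposition R bE.
split.
- apply: comm_algebra_incmul => x y /memv_imgP[u _ ->{x}] /memv_imgP[v _ ->{y}].
  by rewrite -block_factor_mul memv_img ?memvf.
- apply: comm_algebra_incmul => x y /memv_imgP[u _ ->{x}] /memv_imgP[v _ ->{y}].
  by rewrite -outside_factor_mul memv_img ?memvf.
- split.
    by apply/eqP; rewrite eqEsubv even_part_sub AE addvS.
  apply/directv_addP/eqP; rewrite -subv0.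
  move: dirA; rewrite directv_addE /= => /and3P[_ _ /eqP <-].
  exact: capvS.
- move=> x y /memv_imgP[u _ ->{x}] /memv_imgP[v _ ->{y}].
  by rewrite (incmulC _ (f2 v)) block_factor_outside.
Qed.

End Factors.

(** * Nonvanishing of the second factor's product, and the theorem *)

Lemma incmul_trivial_neq0 (K : fieldType) n : (3 <= n)%N ->
  exists x y, incmul (@trivial_dec n) x y != 0 :> incalg K n.
Proof.
case: n => [|[|[|n]]] // _.
pose k0 : 'I_n.+3 := @Ordinal n.+3 0 isT; pose k1 : 'I_n.+3 := @Ordinal n.+3 1 isT.
pose k2 : 'I_n.+3 := @Ordinal n.+3 2 isT.
have [b bE] := @block_set3 _ k0 k1 k2 isT isT isT.
exists (basis_e K [set k0; k1]), (basis_e K [set k0; k2]).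
rewrite (incmul_basis K _ bE) scale1r.
have c12 : #|[set k1; k2]| == 2%N by rewrite cards2.
pose p : point n.+3 := exist _ [set k1; k2] c12.
by apply/eqP=> /ffunP/(_ p)/eqP; rewrite !ffunE eqxx oner_eq0.
Qed.

Lemma val_point2 (p : point 2) : val p = setT.
Proof. by apply/eqP; rewrite eqEcard subsetT cardsT card_ord (eqP (valP p)). Qed.

(** G_2(2) has a single point, so the only product of basis vectors is a square, which is zero. *)
Lemma incalg2_null (K : fieldType) (d : decoration 2) (x y : incalg K 2) :
  incmul d x y = 0.
Proof.
rewrite /incmul big1 // => p _; rewrite big1 // => q _.
have -> : q = p by apply/val_inj; rewrite !val_point2.
by rewrite -(incmul_basisE K d p p) incmul_basis_same scaler0.
Qed.

Lemma dim_incalg2 (K : fieldType) : \dim {: incalg K 2} = 1%N.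
Proof.
(* Functions from the points to a line have dimension the number of points, here binomial(2, 2) =
   1. *)
rewrite dimvf; change (#|{: point 2}| * 1 = 1)%N; rewrite muln1 card_sig.
by have := card_draws 'I_2 2%N; rewrite card_ord binn cardsE.
Qed.

Theorem corollary4p5 (R : realType) (m : nat) (hm : (5 <= m)%N)
    (w i j : 'I_m) (b : block m) (hb : val b = [set w; i; j]) :
  let mul : incalg R m -> incalg R m -> incalg R m := incmul (star_dec w) in
  let mul' : incalg R (m - 3) -> incalg R (m - 3) -> incalg R (m - 3) :=
    incmul (@trivial_dec (m - 3)) in
  let Aplus : {vspace incalg R m} := even_part R b in
  let A (lam : R) : {vspace incalg R m} := block_eigenspace (star_dec w) b lam in
  let A_1 := A 1 in
  let A_mhalf := A (- 2^-1) in
  let A_0 := A 0 in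
  let g : incalg R m :=
    basis_e R [set w; i] + basis_e R [set w; j] + basis_e R [set i; j] in
  let a1 : incalg R m := basis_e R [set w; i] - basis_e R [set w; j] in
  let a2 : incalg R m := basis_e R [set w; i] - basis_e R [set i; j] in
  let F1 : {vspace incalg R m} := <<[:: g; a1; a2]>>%VS in
  [/\ Aplus = (A_1 + A_mhalf + A_0)%VS /\ directv (A_1 + A_mhalf + A_0),
      (exists f : 'Hom((Malg R 2 * incalg R (m - 3))%type, incalg R m),
        alg_iso (prod_mul (@Mmul R 2) mul') mul f Aplus
        /\ (forall x, x \in F1 <-> exists u : Malg R 2, x = f (u, 0))),
      [/\ sym_clifford_system (@dot R 2) (@clifford_R2 R),
          polar_from (@Mmul R 2) (@Mip R 2) fullv (@dot R 2) (@clifford_R2 R) &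
          polar_from mul (@incip R m) F1 (@dot R 2) (@clifford_R2 R)],
      direct_summand mul F1 Aplus /\ polar_algebra mul (@incip R m) F1 &
      ((6 <= m)%N -> exists x y, mul' x y != 0) /\
      (m = 5%N -> \dim {: incalg R (m - 3)} = 1%N /\ forall x y, mul' x y = 0)].
Proof.
move=> mul mul' Aplus A A_1 A_mhalf A_0 g a1 a2 F1.
have F1E : F1 = limg (Malg_emb (basis_e R [set w; i]) (basis_e R [set w; j])
    (basis_e R [set i; j])).
  by rewrite Malg_emb_limg -span_eigenbasis.
set f1 := Malg_emb _ _ _ in F1E; set f2 := incemb R (@outside_block m b).
have f1_inj : injective f1 by exact: (block_factor_inj hb).
have f1_mul : forall u v, f1 (Mmul u v) = mul (f1 u) (f1 v) by exact: (block_factor_mul hb).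
have f1_ip : forall u v, incip (f1 u) (f1 v) = Mip u v by exact: (block_factor_ip hb).
have dprod : direct_product mul Aplus (limg f1) (limg f2).
  exact: even_part_direct_product.
have M_polar := Mmul2_polar_from R.
have F1_polar : polar_from mul (@incip R m) F1 (@dot R 2) (@clifford_R2 R).
  by rewrite F1E; apply: polar_from_img M_polar.
split.
- exact: (even_part_decomposition R hb).
(* The isomorphism is the sum of the two embeddings, so its restriction to the first factor is
   f1. *)
- exists (pair_hom f1 f2); split; last first.
    move=> x; rewrite F1E; split=> [/memv_imgP[u _ ->]|[u ->]].
      by exists u; rewrite pair_homE linear0 addr0.
    by rewrite pair_homE linear0 addr0 memv_img ?memvf.
  apply: pair_hom_alg_iso => //.
  + exact/incemb_inj/outside_block_inj.
  + exact: (outside_factor_mul hb).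
  + by move=> x y z; apply: linearDl.
  + by move=> x y z; apply: linearDr.
- by split=> //; apply: sym_clifford_system_R2.
- split; last exact: polar_from_polar F1_polar.
  by exists (limg f2); rewrite F1E.
- split=> [hm6|m5]; first by exact: incmul_trivial_neq0 (leq_sub2r 3 hm6).
  (* The algebra's type depends on m - 3, so this number is generalized before it is replaced by
     2. *)
  rewrite /mul'; move: (m - 3)%N (congr1 (subn^~ 3) m5) => n /= ->.
  by split; [exact: dim_incalg2|exact: incalg2_null].
Qed.
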